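(* For every tree $T$ of order $n\geq 3$, there is a graph $H$, obtained from $T$ by joining two distinct, nonadjacent vertices of $T$ by an edge, such that $\mu(H)>\mu(T)$.
   Context: Graphs are finite, loopless, and have no multiple edges; the order of a graph is its number of vertices. A subtree of a graph $G$ is a (not necessarily induced) subgraph of $G$ that is a tree; the null graph (with no vertices) is not counted as a subtree, while single vertices are. Let $\mathcal{T}_G$ be the set of subtrees of $G$ and $S_G(x)=\sum_{T\in\mathcal{T}_G}x^{|V(T)|}$. The mean subtree order of $G$ is the average order of a subtree of $G$, that is, $\mu(G)=S_G'(1)/S_G(1)$. *)

(* Defs.v *)
From HB Require Import structures.
From mathcomp Require Import all_boot all_order all_algebra.

Set Implicit Arguments.
Unset Strict Implicit.
Unset Printing Implicit Defensive.

Import GRing.Theory Num.Theory.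

(* A finite simple graph has a vertex set W and an edge set F, whose edges are
   two-element subsets of W.  All vertices live in an ambient finite type U, so
   that a graph and its (not necessarily induced) subgraphs have the same type. *)
Definition is_graph (U : finType) (WF : {set U} * {set {set U}}) : bool :=
  [forall e in WF.2, (#|e| == 2) && (e \subset WF.1)].

Record graph (U : finType) : predArgType := Graph {
  graph_val : {set U} * {set {set U}};
  graph_valP : is_graph graph_val
}.

HB.instance Definition _ (U : finType) := [isSub for @graph_val U].
HB.instance Definition _ (U : finType) := [Finite of graph U by <:].

Definition vertices (U : finType) (G : graph U) : {set U} := (graph_val G).1.
Definition edges (U : finType) (G : graph U) : {set {set U}} := (graph_val G).2.

Definition graph_order (U : finType) (G : graph U) : nat := #|vertices G|.

Definition adjacent (U : finType) (G : graph U) : rel U :=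
  [rel x y | [set x; y] \in edges G].

Definition subgraph (U : finType) (G' G : graph U) : bool :=
  (vertices G' \subset vertices G) && (edges G' \subset edges G).

Definition connected (U : finType) (G : graph U) : bool :=
  [forall x in vertices G, forall y in vertices G, connect (adjacent G) x y].

(* [ucycleb] also accepts the closed walks x, y, x along a single edge (and the
   empty cycle), hence the bound 2 < n.  The upper bound on n only serves to make
   the predicate boolean, see [acyclicP]. *)
Definition acyclic (U : finType) (G : graph U) : bool :=
  [forall n : 'I_#|U|.+1, (2 < n) ==>
    [forall c : n.-tuple U, ~~ ucycleb (adjacent G) c]].

Lemma acyclicP (U : finType) (G : graph U) :
  reflect (forall c : seq U, 2 < size c -> ~ ucycle (adjacent G) c) (acyclic G).
Proof.
apply: (iffP forallP) => [acG c lt2c ucc | acG n].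
  have ltcU : size c < #|U|.+1.
    by rewrite ltnS -(card_uniqP _) ?max_card //; case/andP: ucc.
  move: (acG (Ordinal ltcU)) => /implyP/(_ lt2c)/forallP/(_ (in_tuple c)).
  by move/negP; apply.
apply/implyP => lt2n; apply/forallP => c; apply/negP => ucc.
by apply: (acG c) => //; rewrite size_tuple.
Qed.

(* The null graph is not a tree. *)
Definition is_tree (U : finType) (G : graph U) : bool :=
  [&& vertices G != set0, connected G & acyclic G].

Definition subtrees (U : finType) (G : graph U) : {set graph U} :=
  [set T : graph U | subgraph T G && is_tree T].

Definition subtree_poly (U : finType) (G : graph U) : {poly rat} :=
  (\sum_(T in subtrees G) 'X^(graph_order T))%R.

Definition mean_subtree_order (U : finType) (G : graph U) : rat :=
  ((subtree_poly G)^`().[1] / (subtree_poly G).[1])%R.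

(* Main.v *)
Require Import Defs.
From mathcomp Require Import all_boot all_order all_algebra.
From mathcomp Require Import zify.

(* In a tree, take the end of a longest path: a leaf u, its neighbour v, and a
   further neighbour w of v such that either w is also a leaf or v has degree 2.
   The new edge is uw.  A subtree of T + uw through uw misses one of the other
   two edges of the triangle uvw, so it lives in one of two trees that coincide
   with T away from u, v, w; in both cases all the subtrees involved are obtained
   from those of one smaller tree by attaching pendant vertices.  The inequality
   then reduces to Jamison's theorem on that smaller tree (the mean order of the
   subtrees through a given vertex is at least the mean order of all subtrees),
   together with the fact that at least as many subtrees as there are vertices
   pass through a given vertex. *)

Set Implicit Arguments.
Unset Strict Implicit.
Unset Printing Implicit Defensive.

(** * Connected vertex sets and bridges *)

Definition restr (U : finType) (e : rel U) (W : {set U}) : rel U :=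
  [rel x y | [&& x \in W, y \in W & e x y]].

Definition conn (U : finType) (e : rel U) (W : {set U}) : bool :=
  [forall x in W, forall y in W, connect (restr e W) x y].

(** In an acyclic graph a subtree is determined by its vertex set, so these sets will stand for the
    subtrees inside [A]. *)
Definition csub (U : finType) (e : rel U) (A : {set U}) : {set {set U}} :=
  [set W : {set U} | [&& W \subset A, W != set0 & conn e W]].

Definition bridge (U : finType) (e : rel U) (A1 : {set U}) (w : U) (A2 : {set U}) (c : U) :
    Prop :=
  [/\ [disjoint A1 & A2], w \in A1, c \in A2, e w c
    & forall x y, x \in A1 -> y \in A2 -> e x y -> x = w /\ y = c].

Lemma connP (U : finType) (e : rel U) (W : {set U}) :
  reflect {in W &, forall x y, connect (restr e W) x y} (conn e W).
Proof.
apply: (iffP forall_inP) => [cW x y xW yW | cW x xW].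
  by move/forall_inP: (cW x xW) => /(_ y yW).
by apply/forall_inP => y yW; apply: cW.
Qed.

Lemma restr_sym (U : finType) (e : rel U) (W : {set U}) :
  symmetric e -> connect_sym (restr e W).
Proof.
by move=> se; apply: sym_connect_sym => x y; rewrite /restr /= se andbCA.
Qed.

Lemma connect_homo (U : finType) (e e' : rel U) (r : U -> U) x y :
  (forall a b, e a b -> connect e' (r a) (r b)) ->
  connect e x y -> connect e' (r x) (r y).
Proof.
move=> er /connectP[p]; elim: p x => [|z p IH] x /=; first by move=> _ ->.
by case/andP=> exz pz yl; apply: connect_trans (er _ _ exz) (IH _ pz yl).
Qed.

Lemma connect_restrS (U : finType) (e : rel U) (A B : {set U}) x y :
  A \subset B -> connect (restr e A) x y -> connect (restr e B) x y.
Proof.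
move=> AB; apply: (@connect_homo _ _ _ id) => a b /= /and3P[aA bA eab].
by apply: connect1; rewrite /restr /= !(subsetP AB).
Qed.

Lemma conn_root (U : finType) (e : rel U) (W : {set U}) w :
  symmetric e -> (forall x, x \in W -> connect (restr e W) x w) -> conn e W.
Proof.
move=> se cw; apply/connP => x y xW yW; apply: connect_trans (cw x xW) _.
by rewrite restr_sym // cw.
Qed.

Lemma conn1 (U : finType) (e : rel U) x : conn e [set x].
Proof. by apply/connP => a b /set1P-> /set1P->; apply: connect0. Qed.

Lemma bridge_sym (U : finType) (e : rel U) A1 w A2 c :
  symmetric e -> bridge e A1 w A2 c -> bridge e A2 c A1 w.
Proof.
move=> se [dA wA cA ewc br]; split; rewrite // 1?disjoint_sym 1?se //.
by move=> x y xA yA; rewrite se => /(br _ _ yA xA)[-> ->].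
Qed.

Lemma conn_join (U : finType) (e : rel U) A1 w A2 c (W1 W2 : {set U}) :
  symmetric e -> bridge e A1 w A2 c -> w \in W1 -> c \in W2 ->
  conn e W1 -> conn e W2 -> conn e (W1 :|: W2).
Proof.
move=> se [_ _ _ ewc _] wW cW /connP c1 /connP c2; apply: (@conn_root _ _ _ w) => // x.
case/setUP=> xW; first exact: connect_restrS (subsetUl _ _) (c1 _ _ xW wW).
apply: connect_trans (connect_restrS (subsetUr _ _) (c2 _ _ xW cW)) _.
by apply: connect1; rewrite /restr /= !inE wW cW orbT se.
Qed.

(** If [w] or [c] were missing from [W], no edge inside [W] would leave [A1], so [A1] would be
    closed under [restr e W] and no path in [W] could lead from [x] to [y]. *)
Lemma conn_bridge_ends (U : finType) (e : rel U) A1 w A2 c (W : {set U}) x y :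
  symmetric e -> bridge e A1 w A2 c -> W \subset A1 :|: A2 -> conn e W ->
  x \in W -> x \in A1 -> y \in W -> y \in A2 -> (w \in W) && (c \in W).
Proof.
move=> se [dA _ _ _ br] WA /connP cW xW xA yW yA.
apply: contraT => nwc.
have cl : closed (restr e W) A1.
  have D z : z \in W -> z \notin A1 -> z \in A2.
    by move=> zW; move: (subsetP WA z zW); rewrite inE => /orP[->|].
  have aux a b : restr e W a b -> a \in A1 -> b \in A1.
    move=> /and3P[aW bW eab] aA; apply: contraT => /(D _ bW) bA.
    by have [aw bc] := br _ _ aA bA eab; rewrite -aw -bc aW bW in nwc.
  move=> a b rab; apply/idP/idP; first exact: aux rab.
  by apply: aux; move: rab; rewrite /restr /= se andbCA.
have := closed_connect cl (cW _ _ xW yW).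
by rewrite xA => /esym yA1; have := disjointFr dA yA1; rewrite yA.
Qed.

(* Collapsing the far side of the bridge onto w turns paths of W into paths of W :&: A1. *)
Lemma conn_bridge_side (U : finType) (e : rel U) A1 w A2 c (W : {set U}) :
  symmetric e -> bridge e A1 w A2 c -> W \subset A1 :|: A2 -> conn e W ->
  w \in W -> conn e (W :&: A1).
Proof.
move=> se [dA wA _ _ br] WA /connP cW wW; apply/connP => x y.
move=> /setIP[xW xA] /setIP[yW yA].
pose r z := if z \in A1 then z else w.
suff: connect (restr e (W :&: A1)) (r x) (r y) by rewrite /r xA yA.
apply: connect_homo (cW _ _ xW yW) => a b /and3P[aW bW eab]; rewrite /r.
have D z : z \in W -> z \notin A1 -> z \in A2.
  by move=> zW; move: (subsetP WA z zW); rewrite inE => /orP[->|].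
case: (boolP (a \in A1)) => aA; case: (boolP (b \in A1)) => bA //.
- by apply: connect1; rewrite /restr /= !inE aW bW aA bA.
- by have [-> _] := br _ _ aA (D _ bW bA) eab.
- by rewrite se in eab; have [-> _] := br _ _ bA (D _ aW aA) eab.
Qed.

(** A connected set lies in [A1], lies in [A2], or meets both; in the last case it contains both
    ends of the bridge and is uniquely the union of a connected set through [w] and one through [c].
    An arbitrary [g] covers counts and total orders at once. *)
Lemma csub_sum_join (U : finType) (e : rel U) A1 w A2 c (g : {set U} -> nat) :
  symmetric e -> bridge e A1 w A2 c ->
  \sum_(W in csub e (A1 :|: A2)) g W =
    \sum_(W in csub e A1) g W + \sum_(W in csub e A2) g W
    + \sum_(W1 in csub e A1 | w \in W1) \sum_(W2 in csub e A2 | c \in W2) g (W1 :|: W2).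
Proof.
move=> se br; have [dA wA cA ewc _] := br.
have br' := bridge_sym se br.
have I12 : A1 :&: A2 = set0 by apply/eqP; rewrite setI_eq0.
rewrite (bigID (fun W : {set U} => W \subset A1)) /= -addnA; congr addn.
  apply: eq_bigl => W; rewrite !inE; case: (boolP (W \subset A1)) => WA;
    rewrite ?andbF ?andbT //.
  by rewrite (subset_trans WA (subsetUl _ _)).
rewrite (bigID (fun W : {set U} => W \subset A2)) /=; congr addn.
  apply: eq_bigl => W; rewrite !inE; case: (boolP (W \subset A2)) => WA;
    rewrite ?andbF ?andbT //.
  rewrite (subset_trans WA (subsetUr _ _)) /=; case: (boolP (W == set0)) => //= W0.
  rewrite andbC; case: (boolP (W \subset A1)) => //= WA1.
  by move: W0; rewrite -subset0 -I12 subsetI WA WA1.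
rewrite pair_big_dep /=.
(* Sets meeting both sides are reindexed by their traces on [A1] and [A2]. *)
rewrite (reindex_onto (fun p : {set U} * {set U} => p.1 :|: p.2)
          (fun W => (W :&: A1, W :&: A2))) /=; last first.
  move=> W; rewrite !inE => /andP[/andP[/and3P[WA _ _] _] _].
  by rewrite -setIUr; apply/setIidPl.
apply: eq_bigl => -[W1 W2] /=; rewrite !inE.
apply/idP/idP.
  move: (W1 :|: W2) => W.
  case/andP=> /andP[/andP[/and3P[WA W0 cW] n1] n2] /eqP[E1 E2].
  have D : forall z, z \in W -> z \in A1 :|: A2 by exact: subsetP.
  have [y yW yA] : exists2 y, y \in W & y \in A2.
    have /subsetPn[y yW yA] := n1; exists y => //.
    by have := D y yW; rewrite inE (negPf yA).
  have [x xW xA] : exists2 x, x \in W & x \in A1.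
    have /subsetPn[x xW xA] := n2; exists x => //.
    by have := D x xW; rewrite inE (negPf xA) orbF.
  have /andP[wW cWW] := conn_bridge_ends se br WA cW xW xA yW yA.
  rewrite -E1 -E2 !inE wA cA wW cWW !subsetIr /= !andbT.
  rewrite (conn_bridge_side se br WA cW wW).
  rewrite (conn_bridge_side se br' _ cW cWW) 1?setUC //.
  rewrite !andbT; apply/andP; split; apply/set0Pn.
    by exists x; rewrite inE xW.
  by exists y; rewrite inE yW.
case/andP=> /andP[/and3P[W1A W10 c1] wW] /andP[/and3P[W2A W20 c2] cW].
have E1 : (W1 :|: W2) :&: A1 = W1.
  rewrite setIUl (setIidPl W1A) (_ : W2 :&: A1 = set0) ?setU0 //.
  by apply/eqP; rewrite -subset0 -I12 setIC setIS.
have E2 : (W1 :|: W2) :&: A2 = W2.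
  rewrite setIUl (setIidPl W2A) (_ : W1 :&: A2 = set0) ?set0U //.
  by apply/eqP; rewrite -subset0 -I12 setSI.
rewrite E1 E2 eqxx andbT setUSS //= (conn_join se br wW cW c1 c2) andbT.
have n1 : ~~ (W1 :|: W2 \subset A1).
  apply/subsetPn; exists c; first by rewrite inE cW orbT.
  by apply/negP => cA1; have := disjointFr dA cA1; rewrite cA.
have n2 : ~~ (W1 :|: W2 \subset A2).
  apply/subsetPn; exists w; first by rewrite inE wW.
  by apply/negP => cA1; have := disjointFr dA wA; rewrite cA1.
rewrite n1 n2 !andbT; apply/set0Pn; exists w; by rewrite inE wW.
Qed.

(** * Local and global means *)

Lemma csub_sum_join_root (U : finType) (e : rel U) A1 w A2 c (g : {set U} -> nat) :
  symmetric e -> bridge e A1 w A2 c ->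
  \sum_(W in csub e (A1 :|: A2) | w \in W) g W =
    \sum_(W in csub e A1 | w \in W) g W
    + \sum_(W1 in csub e A1 | w \in W1) \sum_(W2 in csub e A2 | c \in W2) g (W1 :|: W2).
Proof.
move=> se br; have [dA wA _ _ _] := br.
(* Moving the condition on [w] into the summand makes the unrestricted decomposition applicable; the
   sets inside [A2] then contribute 0. *)
rewrite big_mkcondr (csub_sum_join _ se br) -big_mkcondr /=.
rewrite [X in _ + X + _]big1 ?addn0; last first.
  move=> W; rewrite inE => /and3P[WA _ _]; case: ifP => // wW.
  by have := disjointFr dA wA; rewrite (subsetP WA).
congr addn; apply: eq_bigr => W1 /andP[_ wW]; apply: eq_bigr => W2 _.
by rewrite inE wW.
Qed.

Lemma cards_join_sum (U : finType) (e : rel U) (A1 A2 : {set U}) w c :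
  [disjoint A1 & A2] ->
  \sum_(W1 in csub e A1 | w \in W1) \sum_(W2 in csub e A2 | c \in W2) #|W1 :|: W2| =
    (\sum_(W1 in csub e A1 | w \in W1) #|W1|) * (\sum_(W2 in csub e A2 | c \in W2) 1)
    + (\sum_(W1 in csub e A1 | w \in W1) 1) * (\sum_(W2 in csub e A2 | c \in W2) #|W2|).
Proof.
move=> dA; rewrite !big_distrlr /= -big_split /=.
apply: eq_bigr => W1; rewrite inE => /andP[/and3P[W1A _ _] _].
rewrite -big_split /=; apply: eq_bigr => W2; rewrite inE => /andP[/and3P[W2A _ _] _].
rewrite muln1 mul1n cardsU (_ : W1 :&: W2 = set0) ?cards0 ?subn0 //.
by apply/eqP; rewrite setI_eq0; apply: disjointWl W1A (disjointWr W2A dA).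
Qed.

Lemma csub1 (U : finType) (e : rel U) w : csub e [set w] = [set [set w]].
Proof.
apply/setP => W; rewrite !inE subset1; case: eqP => [->|_] /=.
  by rewrite conn1 -card_gt0 cards1.
by case: eqP.
Qed.

(* Unlike acyclicity, this decomposition supports induction: A is cut along an
   edge at its root, and both parts are again rooted at an end of that edge. *)
Inductive rtree (U : finType) (e : rel U) : {set U} -> U -> Prop :=
| Rtree1 w : rtree e [set w] w
| RtreeJoin A1 w A2 c : bridge e A1 w A2 c -> rtree e A1 w -> rtree e A2 c ->
    rtree e (A1 :|: A2) w.

Lemma csub_weight_le (U : finType) (e : rel U) (A : {set U}) (P : pred {set U}) :
  \sum_(W in csub e A | P W) #|W| <= #|A| * \sum_(W in csub e A | P W) 1.
Proof.
rewrite big_distrr /=; apply: leq_sum => W; rewrite inE => /andP[/and3P[WA _ _] _].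
by rewrite muln1 subset_leq_card.
Qed.

Lemma csub_count_le (U : finType) (e : rel U) (A : {set U}) (P : pred {set U}) :
  \sum_(W in csub e A | P W) 1 <= \sum_(W in csub e A | P W) #|W|.
Proof.
apply: leq_sum => W; rewrite inE => /andP[/and3P[_ W0 _] _].
by rewrite card_gt0.
Qed.

(* The induction step of Jamison's inequality: t and s stand for the number and the
   total order of the subtrees on one side of a bridge, f and g for the same
   quantities restricted to the subtrees through the end of the bridge. *)
Lemma mean_join_le t1 s1 f1 g1 t2 s2 f2 g2 :
  f1 <= t1 -> g1 <= s1 -> f1 <= g1 -> 0 < f2 -> g2 <= f2 * f2 ->
  s1 * f1 <= t1 * g1 -> s2 * f2 <= t2 * g2 ->
  (s1 + s2 + (g1 * f2 + f1 * g2)) * (f1 + f1 * f2)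
    <= (t1 + t2 + f1 * f2) * (g1 + (g1 * f2 + f1 * g2)).
Proof.
(* Writing [t1] as [f1 + a] and [s1] as [g1 + b] turns the hypothesis on the first side into
   [b * f1 <= a * g1]. *)
move=> /subnKC <-; move: (t1 - f1) => a; move=> /subnKC <-; move: (s1 - g1) => b.
move=> fg f20 g2f H1 H2.
have H1' : b * f1 * (1 + f2) <= a * g1 * (1 + f2).
    apply: leq_mul => //; clear -H1.
    by move: H1; rewrite !mulnDl [f1 * g1]mulnC leq_add2l.
(* Multiplying by [f2] brings in the hypothesis on the second side. Of the resulting bound, the part
   with the factor [f2] matches [t2 * f1 * g2]; the rest is absorbed using [g2 <= f2 * f2] and
   [f1 <= g1]. *)
have H2' : s2 * f1 * (1 + f2) <= t2 * (g1 * (1 + f2) + f1 * g2).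
  rewrite -(leq_pmul2l f20).
  have K1 : s2 * f2 * (f1 * (1 + f2)) <= t2 * g2 * (f1 * (1 + f2)).
    by rewrite leq_mul2r H2 orbT.
  have K2 : t2 * (g2 * f1) <= t2 * (f2 * f2 * g1) by rewrite leq_mul2l leq_mul ?orbT.
  nia.
nia.
Qed.

Lemma count_join (U : finType) (e : rel U) (A1 A2 : {set U}) w c :
  \sum_(W1 in csub e A1 | w \in W1) \sum_(W2 in csub e A2 | c \in W2) 1 =
    (\sum_(W1 in csub e A1 | w \in W1) 1) * (\sum_(W2 in csub e A2 | c \in W2) 1).
Proof. by rewrite big_distrlr. Qed.

(** With [f1] and [f2] the counts on the two sides of the bridge, [f1 + f1 * f2] sets pass through
    [w]; as [f1] is positive, induction makes this at least [#|A1| + #|A2|]. *)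
Lemma rtree_count (U : finType) (e : rel U) (A : {set U}) w :
  symmetric e -> rtree e A w ->
  #|A| <= \sum_(W in csub e A | w \in W) 1.
Proof.
move=> se; elim=> {A w} [w|A1 w A2 c br _ IH1 _ IH2].
  by rewrite cards1 big_mkcondr csub1 big_set1 set11.
rewrite (csub_sum_join_root _ se br) count_join.
have [_ wA cA _ _] := br.
have : 0 < #|A1| by apply/card_gt0P; exists w.
move=> /leq_trans/(_ IH1) f1_gt0.
apply: leq_trans (leq_add IH1 (leq_trans IH2 (leq_pmull _ f1_gt0))).
exact: leq_card_setU.
Qed.

(* Jamison's inequality between the global and the local mean, cross-multiplied. *)
Lemma rtree_mean_le (U : finType) (e : rel U) (A : {set U}) w :
  symmetric e -> rtree e A w ->
  (\sum_(W in csub e A) #|W|) * (\sum_(W in csub e A | w \in W) 1)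
    <= (\sum_(W in csub e A) 1) * (\sum_(W in csub e A | w \in W) #|W|).
Proof.
move=> se; elim=> {A w} [w|A1 w A2 c br _ IH1 rt2 IH2].
  by rewrite !big_mkcondr csub1 !big_set1 set11 mulnC.
rewrite !(csub_sum_join_root _ se br) !(csub_sum_join _ se br) count_join.
have [dA _ cA _ _] := br.
have cnt2 := rtree_count se rt2.
have wt2 := csub_weight_le e A2 (fun W => c \in W).
have A2_gt0 : 0 < #|A2| by apply/card_gt0P; exists c.
rewrite cards_join_sum //; apply: mean_join_le => //.
- by rewrite [X in X <= _]big_mkcondr; apply: leq_sum => W _; case: ifP.
- by rewrite [X in X <= _]big_mkcondr; apply: leq_sum => W _; case: ifP.
- exact: csub_count_le.
- exact: leq_trans cnt2.
(* Each set has at most [#|A2|] vertices, and at least [#|A2|] sets pass through [c]; this gives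
   [g2 <= f2 * f2]. *)
- by apply: leq_trans wt2 _; rewrite leq_mul2r cnt2 orbT.
Qed.

(** * Decomposing trees along bridges *)

Definition acyc (U : finType) (e : rel U) : Prop :=
  forall c : seq U, 2 < size c -> ~ ucycle e c.

Lemma connect_restr_mem (U : finType) (e : rel U) (B : {set U}) c z :
  c \in B -> connect (restr e B) c z -> z \in B.
Proof.
move=> cB cz; rewrite -(closed_connect _ cz) // => a b /and3P[aB bB _].
by rewrite aB bB.
Qed.

Lemma conn_component (U : finType) (e : rel U) (B : {set U}) c :
  symmetric e -> conn e [set z | connect (restr e B) c z].
Proof.
move=> se; set C := finset _; apply: (@conn_root _ _ _ c) => // x xC.
have : connect (restr e B) x c by rewrite restr_sym // -(in_set (connect _ c)).
case/connectP=> p; elim: p x xC => [|z p IH] x xC /=; first by move=> _ ->.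
case/andP=> xz pz lc.
have zC : z \in C by move: xC; rewrite !inE => /connect_trans; apply; apply: connect1.
apply: connect_trans (IH _ zC pz lc); apply: connect1.
by rewrite /restr /= xC zC; case/and3P: xz.
Qed.

(** Induction on the size of [A]: the component [A2] of a neighbour [c] of [w] in [A] without [w] is
    split off. Edges between [A2] and the rest start at [w], and acyclicity leaves only the edge to
    [c]. *)
Lemma conn_rtree (U : finType) (e : rel U) (A : {set U}) w :
  symmetric e -> irreflexive e -> acyc e -> conn e A -> w \in A -> rtree e A w.
Proof.
move=> se ie ac; move: {2}#|A| (leqnn #|A|) => n.
elim: n A w => [|n IH] A w leA cA wA.
  by move: leA; rewrite leqn0 cards_eq0 => /eqP A0; rewrite A0 inE in wA.
have [-> | Aw] := eqVneq A [set w]; first exact: Rtree1.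
have [c cA' ewc] : exists2 c, c \in A & e w c.
  have [x xA xw] : exists2 x, x \in A & x != w.
    apply/exists_inP; apply: contraNT Aw => /exists_inPn H.
    rewrite eqEsubset sub1set wA andbT; apply/subsetP => x xA.
    by rewrite inE; have := H x xA; rewrite negbK.
  have /connectP[[|c p] /=] := connP _ _ cA _ _ wA xA.
    by move=> _ xw'; rewrite xw' eqxx in xw.
  by case/andP=> /and3P[_ cA' ewc] _ _; exists c.
set B := A :\ w; pose A2 := [set z | connect (restr e B) c z].
have cB : c \in B.
  rewrite !inE cA' andbT; by apply: contraTneq ewc => ->; rewrite ie.
have A2B z : z \in A2 -> z \in B by rewrite inE; apply: connect_restr_mem.
have cA2 : c \in A2 by rewrite inE connect0.
have wA2 : w \notin A2 by apply/negP => /A2B; rewrite !inE eqxx.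
have sA2 : A2 \subset A by apply/subsetP => z /A2B; rewrite !inE => /andP[].
have out x y : x \in A -> x \notin A2 -> y \in A2 -> e x y -> x = w.
  move=> xA xA2 yA2 exy; apply: contraNeq xA2 => xw; move: (yA2); rewrite !inE => cy.
  apply: connect_trans cy _; apply: connect1.
  by rewrite /restr /= A2B // !inE xw xA /= se.
have cA2c : conn e A2 by exact: conn_component.
have wA1 : w \in A :\: A2 by rewrite inE wA wA2.
have cA1 : conn e (A :\: A2).
  apply: (@conn_root _ _ _ w) => // x xA1.
  have xA : x \in A by move: xA1; rewrite inE => /andP[].
  have /connectP[p] := connP _ _ cA _ _ xA wA.
  elim: p x xA1 {xA} => [|z p IHp] x xA1 /=; first by move=> _ ->.
  case/andP=> /and3P[xA zA exz] pz lw.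
  (* A path towards [w] can enter [A2] only from [w] itself, so at that point [w] has already been
     reached. *)
  have [zA2 | zA2] := boolP (z \in A2).
    by rewrite (out x z) // ; move: xA1; rewrite inE => /andP[].
  have zA1 : z \in A :\: A2 by rewrite inE zA2.
  apply: connect_trans (IHp _ zA1 pz lw); apply: connect1.
  by rewrite /restr /= xA1 zA1.
have br : bridge e (A :\: A2) w A2 c.
  split=> //.
    by rewrite disjoint_sym disjoints_subset; apply/subsetP => z; rewrite !inE => ->.
  move=> x y /setDP[xA xA2] yA2 exy; have xw := out x y xA xA2 yA2 exy; split=> //.
  (* A second edge from [w] to some [y] in [A2] would close a cycle with a simple path from [c] to
     [y], which avoids [w] because it runs in [B]. *)
  apply/eqP; apply: contraT => yc; move: (yA2); rewrite inE => /connectP[p0 pp0 yl0].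
  case: (shortenP pp0) yl0 => p pp up _ yl.
  have pB : all (mem B) (c :: p).
    rewrite /= cB /=; elim: (p) (c) pp => //= z q IHq d /andP[/and3P[_ zB _] zq].
    by rewrite zB /=; apply: IHq zq.
  have := ac (w :: c :: p); case; first by case: (p) yl yc => //= ->; rewrite eqxx.
  rewrite /ucycle [cycle _ _]/= ewc /= rcons_path -yl -xw se exy andbT.
  have /= -> : path e c p by apply: sub_path pp => a b /and3P[].
  rewrite -[_ && _]/(uniq (x :: c :: p)) cons_uniq up andbT.
  apply/negP => /(allP pB); by rewrite !inE xw eqxx.
have -> : A = (A :\: A2) :|: A2 by rewrite -{1}(setID A A2) (setIidPr sA2) setUC.
apply: RtreeJoin br _ _; apply: IH => //.
  rewrite -ltnS; apply: leq_trans leA; apply: proper_card.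
  by apply/properP; split; [exact: subsetDl | exists c; rewrite // inE cA2].
rewrite -ltnS; apply: leq_trans leA; apply: proper_card.
by apply/properP; split=> //; exists w.
Qed.

(** * Subtrees as connected vertex sets *)

Lemma edge_card2 (U : finType) (G : graph U) f : f \in edges G -> #|f| = 2.
Proof. by move=> fG; have /forall_inP/(_ f fG)/andP[/eqP] := graph_valP G. Qed.

Lemma edge_sub (U : finType) (G : graph U) f : f \in edges G -> f \subset vertices G.
Proof. by move=> fG; have /forall_inP/(_ f fG)/andP[] := graph_valP G. Qed.

Lemma graph_inj (U : finType) (G G' : graph U) :
  vertices G = vertices G' -> edges G = edges G' -> G = G'.
Proof.
move=> eqV eqE; apply: val_inj; rewrite /= (surjective_pairing (graph_val G)).
by rewrite (surjective_pairing (graph_val G')); congr pair.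
Qed.

Lemma adjacent_sym (U : finType) (G : graph U) : symmetric (adjacent G).
Proof. by move=> x y; rewrite /adjacent /= setUC. Qed.

Lemma adjacent_irr (U : finType) (G : graph U) : irreflexive (adjacent G).
Proof. by move=> x; apply/negP => /edge_card2; rewrite setUid cards1. Qed.

Lemma adjacent_mem (U : finType) (G : graph U) x y :
  adjacent G x y -> (x \in vertices G) && (y \in vertices G).
Proof. by move/edge_sub; rewrite subUset !sub1set. Qed.

Lemma induced_is_graph (U : finType) (G : graph U) (W : {set U}) :
  is_graph (W, [set f in edges G | f \subset W]).
Proof.
by apply/forall_inP => f; rewrite inE => /andP[/edge_card2 -> ->].
Qed.

Definition induced (U : finType) (G : graph U) (W : {set U}) : graph U :=
  Graph (induced_is_graph G W).

Lemma adjacent_induced (U : finType) (G : graph U) (W : {set U}) :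
  adjacent (induced G W) =2 restr (adjacent G) W.
Proof.
move=> x y; rewrite /adjacent /restr /= inE subUset !sub1set.
by rewrite andbC -andbA.
Qed.

Lemma connected_induced (U : finType) (G : graph U) (W : {set U}) :
  connected (induced G W) = conn (adjacent G) W.
Proof.
apply: eq_forallb_in => x _; apply: eq_forallb_in => y _.
exact: (eq_connect (adjacent_induced G W)).
Qed.

Lemma acyc_sub (U : finType) (e e' : rel U) : subrel e e' -> acyc e' -> acyc e.
Proof.
move=> ee ac c c2 /andP[cc uc]; apply: (ac c c2); rewrite /ucycle uc andbT.
exact: sub_cycle cc.
Qed.

(** An edge of [G] between two vertices of [S] that is missing from [S] would close a cycle with the
    path joining them in [S]. *)
Lemma subtree_induced (U : finType) (G S : graph U) :
  acyclic G -> S \in subtrees G -> induced G (vertices S) = S.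
Proof.
move=> /acyclicP acG; rewrite inE => /andP[/andP[VS ES] /and3P[_ cS _]].
apply: graph_inj => //; apply/setP => f; rewrite [LHS]inE; apply/andP/idP; last first.
  by move=> fS; rewrite (subsetP ES) // edge_sub.
case=> fG fV; have /eqP/cards2P[x [y [xy fxy]]] := edge_card2 fG.
move: fV; rewrite fxy subUset !sub1set => /andP[xS yS].
apply: contraT => nxy.
have /connectP[p0 pp0 yl0] := forall_inP (forall_inP cS x xS) y yS.
case: (shortenP pp0) yl0 => p pp up _ yl.
(* The path has at least two edges: length 0 would give [x = y], and length 1 would be the missing
   edge. *)
case: (acG (x :: p)); first case: p yl pp {up} => [|z [|t q]] //=.
- by move=> yx; rewrite yx eqxx in xy.
- by move=> <-; rewrite andbT /adjacent /= (negPf nxy).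
rewrite /ucycle up andbT /= rcons_path -yl; apply/andP; split.
  by apply: sub_path pp => a b; apply: subsetP.
by rewrite adjacent_sym /adjacent /= -fxy.
Qed.

(** [induced] and [vertices] are mutually inverse bijections between connected vertex sets and
    subtrees, as induced subgraphs inherit acyclicity. *)
Lemma sum_subtrees (U : finType) (G : graph U) (P : pred {set U}) (g : {set U} -> nat) :
  acyclic G ->
  \sum_(S in subtrees G | P (vertices S)) g (vertices S)
    = \sum_(W in csub (adjacent G) (vertices G) | P W) g W.
Proof.
move=> acG; rewrite (reindex_onto (induced G) (@vertices U)) /=; last first.
  by move=> S /andP[SG _]; exact: subtree_induced.
apply: eq_bigl => W; rewrite eqxx andbT !inE; congr andb.
rewrite /is_tree connected_induced /subgraph /=.
rewrite -andbA; congr andb; rewrite [X in X && _](_ : _ = true) /=; last first.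
  by apply/subsetP => f; rewrite inE => /andP[].
rewrite andbA [X in _ && X](_ : _ = true) ?andbT //.
apply/acyclicP; apply: acyc_sub (acyclicP _ acG) => x y.
by rewrite adjacent_induced => /and3P[].
Qed.

Lemma ucycle_two_nbrs (U : finType) (e : rel U) c x :
  symmetric e -> ucycle e c -> 2 < size c -> x \in c ->
  exists y z, [/\ y \in c, z \in c, y != z, e x y & e x z].
Proof.
move=> se /andP[cc uc] c2 xc; have [i c' rc] := rot_to xc.
have memc : c =i x :: c' by move=> t; rewrite -rc mem_rot.
move: c2 uc cc; rewrite -(size_rot i) -(rot_uniq i) -(rot_cycle i) rc.
case: c' {rc} memc => [|y c'] memc //; case/lastP: c' memc => [|q z] memc // _.
rewrite /= rcons_path last_rcons => /and3P[_ yq _] /and3P[exy _ ezx].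
have zq : z \in rcons q z by rewrite mem_rcons mem_head.
exists y, z; rewrite !memc !inE zq eqxx !orbT exy se ezx; split=> //.
by apply: contraNneq yq => ->.
Qed.

(** Uniqueness of the neighbour is required only within [c], so that vertices can be excluded from a
    cycle one after another. *)
Lemma ucycle_leaf (U : finType) (e : rel U) c x :
  symmetric e -> ucycle e c -> 2 < size c ->
  {in c &, forall y z, e x y -> e x z -> y = z} -> x \notin c.
Proof.
move=> se uc c2 H; apply/negP => xc.
have [y [z [yc zc yz exy exz]]] := ucycle_two_nbrs se uc c2 xc.
by rewrite (H y z) ?eqxx in yz.
Qed.

Lemma csub_eq (U : finType) (e e' : rel U) (A : {set U}) :
  {in A &, e =2 e'} -> csub e A = csub e' A.
Proof.
move=> ee; apply/setP => W; rewrite !inE; case: (boolP (W \subset A)) => //= WA.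
congr andb; apply: eq_forallb_in => x _; apply: eq_forallb_in => y _.
apply: eq_connect => a b; rewrite /restr /=.
case: (boolP (a \in W)) => //= aW; case: (boolP (b \in W)) => //= bW.
by apply: ee; apply: (subsetP WA).
Qed.

(** Only the edges from [x] into [A] are constrained: [x] may have further neighbours outside [A],
    which allows pendant vertices to be attached in succession. *)
Definition pendant (U : finType) (e : rel U) (A : {set U}) y x : Prop :=
  [/\ x \notin A, y \in A & {in A, e x =1 pred1 y}].

Lemma pendant_bridge (U : finType) (e : rel U) (A : {set U}) y x :
  symmetric e -> pendant e A y x -> bridge e A y [set x] x.
Proof.
move=> se [xA yA exy]; split; rewrite ?set11 //.
- by rewrite disjoint_sym disjoints_subset sub1set inE.
- by rewrite se exy ?inE.
- by move=> z _ zA /set1P-> ; rewrite se exy // => /eqP.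
Qed.

Lemma csub_sum_pendant (U : finType) (e : rel U) (A : {set U}) y x (g : {set U} -> nat) :
  symmetric e -> pendant e A y x ->
  \sum_(W in csub e (x |: A)) g W =
    \sum_(W in csub e A) g W + g [set x] + \sum_(W in csub e A | y \in W) g (x |: W).
Proof.
move=> se /(pendant_bridge se) br; rewrite setUC (csub_sum_join _ se br) csub1 big_set1.
by congr addn; apply: eq_bigr => W _; rewrite big_mkcondr big_set1 set11 setUC.
Qed.

Lemma csub_sum_path2 (U : finType) (e : rel U) (A : {set U}) a x y (g : {set U} -> nat) :
  symmetric e -> pendant e A a x -> pendant e (x |: A) x y ->
  \sum_(W in csub e (y |: (x |: A))) g W =
    \sum_(W in csub e A) g W + g [set x] + \sum_(W in csub e A | a \in W) g (x |: W)
    + g [set y] + (g [set y; x] + \sum_(W in csub e A | a \in W) g (y |: (x |: W))).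
Proof.
move=> se px py; rewrite (csub_sum_pendant _ se py) (csub_sum_pendant _ se px).
congr addn; rewrite big_mkcondr (csub_sum_pendant _ se px) set11.
rewrite [X in X + _ + _]big1 ?add0n; last first.
  move=> W; rewrite inE => /and3P[/subsetP WA _ _]; case: ifP => // /WA xA.
  by case: px => /negP.
by congr addn; apply: eq_bigr => W _; rewrite setU11.
Qed.

Lemma csub_sum_star2 (U : finType) (e : rel U) (A : {set U}) a x y (g : {set U} -> nat) :
  symmetric e -> pendant e A a x -> pendant e (x |: A) a y ->
  \sum_(W in csub e (y |: (x |: A))) g W =
    \sum_(W in csub e A) g W + g [set x] + \sum_(W in csub e A | a \in W) g (x |: W)
    + g [set y] + (\sum_(W in csub e A | a \in W) g (y |: W)
                   + \sum_(W in csub e A | a \in W) g (y |: (x |: W))).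
Proof.
move=> se px py; rewrite (csub_sum_pendant _ se py) (csub_sum_pendant _ se px).
have [xA aA _] := px.
have ax : a != x by apply: contraTneq aA => ->.
congr addn; rewrite big_mkcondr (csub_sum_pendant _ se px) inE (negPf ax) addn0.
rewrite -big_mkcondr; congr addn.
by apply: eq_bigr => W /andP[_ aW]; rewrite inE aW orbT.
Qed.

(** A subtree of [H] without the edge [uw] is a subtree of [T]. One using [uw] either misses [vw],
    and is a subtree of [H1], or uses [vw], hence misses [uv], and is a subtree of [H2]. *)
Lemma sum_subtrees_triangle (U : finType) (T H H1 H2 : graph U) u v w
    (g : {set U} -> nat) :
  u != v -> v != w -> u != w ->
  [set u; v] \in edges T -> [set v; w] \in edges T -> [set u; w] \notin edges T ->
  vertices H = vertices T -> edges H = [set u; w] |: edges T ->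
  vertices H1 = vertices T -> edges H1 = edges H :\ [set v; w] ->
  vertices H2 = vertices T -> edges H2 = edges H :\ [set u; v] ->
  acyclic H1 -> acyclic H2 ->
  \sum_(S in subtrees H) g (vertices S) =
    \sum_(S in subtrees T) g (vertices S)
    + (\sum_(S in subtrees H1 | (u \in vertices S) && (w \in vertices S)) g (vertices S)
    + \sum_(S in subtrees H2 | [&& u \in vertices S, v \in vertices S & w \in vertices S])
        g (vertices S)).
Proof.
move=> uv vw uw Tuv Tvw Tuw VH EH VH1 EH1 VH2 EH2 ac1 ac2.
have neq a b c d : a != c -> a != d -> [set a; b] != [set c; d] :> {set U}.
  move=> ac ad; apply: contraTneq (set21 a b) => ->.
  by rewrite !inE negb_or ac ad.
rewrite addnC (bigID (fun S => [set u; w] \in edges S)) /=; congr addn; last first.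
  apply: eq_bigl => S; rewrite !inE /subgraph VH EH.
  case: (is_tree S); case: (_ \subset _); rewrite ?andbF //= !andbT andbC.
  apply/andP/idP => [[nS /subsetP ES] | ES].
    apply/subsetP => f fS; have := ES f fS; rewrite !inE => /orP[/eqP fu|//].
    by case/negP: nS; rewrite -fu.
  split; last exact: subset_trans ES (subsetUr _ _).
  by apply: contra Tuw; apply: subsetP.
rewrite (bigID (fun S => [set v; w] \in edges S)) /= addnC; congr addn.
  apply: eq_bigl => S; apply/idP/idP.
    case/andP=> /andP[SH uwS] vwS; have := edge_sub uwS.
    rewrite subUset !sub1set => /andP[-> ->]; rewrite andbT.
    move: SH; rewrite !inE /subgraph VH VH1 EH1 => /andP[/andP[-> ES] ->].
    by rewrite subsetD1 ES vwS.
  case/and3P=> SH1 uS wS.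
  (* Subtrees of an acyclic graph are induced, so containing [u] and [w] forces the edge [uw]. *)
  have EI := subtree_induced ac1 SH1.
  move: (SH1); rewrite !inE /subgraph VH VH1 EH1 subsetD1.
  case/andP=> /and3P[-> -> nvw] ->; rewrite nvw !andbT /=.
  rewrite -EI /= inE subUset !sub1set uS wS EH1 !andbT !inE EH !inE eqxx /=.
  by rewrite neq // eq_sym.
apply: eq_bigl => S; apply/idP/idP.
  case/andP=> /andP[SH uwS] vwS.
  have := edge_sub uwS; have := edge_sub vwS.
  rewrite !subUset !sub1set => /andP[-> _] /andP[-> ->]; rewrite !andbT.
  move: SH; rewrite !inE /subgraph VH VH2 EH2 => /andP[/andP[-> ES] tS].
  rewrite tS subsetD1 ES andbT /=; apply/negP => uvS.
  (* Otherwise [u], [v], [w] would form a cycle in [S]. *)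
  case/and3P: tS => _ _ /acyclicP/(_ [:: u; v; w] isT); apply.
  rewrite /ucycle /= /adjacent /= uvS vwS [_ |: [set u]]setUC uwS.
  by rewrite !inE negb_or uv uw vw.
case/and4P=> SH2 uS vS wS.
have EI := subtree_induced ac2 SH2.
move: (SH2); rewrite !inE /subgraph VH VH2 EH2 subsetD1.
case/andP=> /and3P[-> -> nuv] ->; rewrite /=.
rewrite -EI /= !inE !subUset !sub1set uS wS vS EH2 !inE EH !inE Tvw eqxx orbT /= !andbT.
apply/andP; split.
  by rewrite setUC; apply: neq; rewrite eq_sym.
by rewrite [[set v; w]]setUC; apply: neq; rewrite eq_sym.
Qed.

(** * Two pendant vertices *)

Lemma cards_csubU (U : finType) (e : rel U) (A : {set U}) x W :
  x \notin A -> W \in csub e A -> #|x |: W| = #|W|.+1.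
Proof.
move=> xA; rewrite inE => /and3P[WA _ _]; rewrite cardsU1.
by rewrite (contra _ xA) //; apply: subsetP.
Qed.

Lemma cards_csubU2 (U : finType) (e : rel U) (A : {set U}) x y W :
  x \notin A -> y \notin x |: A -> W \in csub e A -> #|y |: (x |: W)| = #|W|.+2.
Proof.
move=> xA yA WA; rewrite cardsU1 (cards_csubU xA WA).
move: WA; rewrite inE => /and3P[WA _ _].
by rewrite (contra _ yA) //; apply: subsetP; apply: setUS.
Qed.

Lemma csub_notin (U : finType) (e : rel U) (A : {set U}) x W :
  x \notin A -> W \in csub e A -> (x \in W) = false.
Proof.
by move=> xA; rewrite inE => /and3P[WA _ _]; apply: contraNF xA; apply: subsetP.
Qed.

(** The identity as [h] gives the total order, the constant 1 the number of sets. *)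
Lemma path2_sum (U : finType) (e : rel U) (A : {set U}) a x y (h : nat -> nat) :
  symmetric e -> pendant e A a x -> pendant e (x |: A) x y ->
  \sum_(W in csub e (y |: (x |: A))) h #|W| =
    \sum_(W in csub e A) h #|W| + h 1 + \sum_(W in csub e A | a \in W) h #|W|.+1
    + h 1 + (h 2 + \sum_(W in csub e A | a \in W) h #|W|.+2).
Proof.
move=> se px py; have [xA aA _] := px; have [yA _ _] := py.
rewrite (csub_sum_path2 _ se px py) !cards1 cards2.
have -> : y != x by apply: contraNneq yA => ->; rewrite setU11.
congr (_ + _ + _ + _ + (_ + _)); apply: eq_bigr => W /andP[WA _].
  by rewrite (cards_csubU xA WA).
by rewrite (cards_csubU2 xA yA WA).
Qed.

Lemma star2_sum (U : finType) (e : rel U) (A : {set U}) a x y (h : nat -> nat) :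
  symmetric e -> pendant e A a x -> pendant e (x |: A) a y ->
  \sum_(W in csub e (y |: (x |: A))) h #|W| =
    \sum_(W in csub e A) h #|W| + h 1 + \sum_(W in csub e A | a \in W) h #|W|.+1
    + h 1 + (\sum_(W in csub e A | a \in W) h #|W|.+1
             + \sum_(W in csub e A | a \in W) h #|W|.+2).
Proof.
move=> se px py; have [xA aA _] := px; have [yA _ _] := py.
have yA' : y \notin A by apply: contra yA => yA; rewrite inE yA orbT.
rewrite (csub_sum_star2 _ se px py) !cards1.
congr (_ + _ + _ + _ + (_ + _)); apply: eq_bigr => W /andP[WA _].
- by rewrite (cards_csubU xA WA).
- by rewrite (cards_csubU yA' WA).
- by rewrite (cards_csubU2 xA yA WA).
Qed.

Lemma path2_sum_ax (U : finType) (e : rel U) (A : {set U}) a x y (h : nat -> nat) :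
  symmetric e -> pendant e A a x -> pendant e (x |: A) x y ->
  \sum_(W in csub e (y |: (x |: A)) | (x \in W) && (a \in W)) h #|W| =
    \sum_(W in csub e A | a \in W) h #|W|.+1 + \sum_(W in csub e A | a \in W) h #|W|.+2.
Proof.
move=> se px py; have [xA aA _] := px; have [yA _ _] := py.
have ax : a != x by apply: contraTneq aA => ->.
have ay : a != y by apply: contraNneq yA => <-; rewrite inE aA orbT.
rewrite big_mkcondr (csub_sum_path2 _ se px py) !inE (negPf ax) (negPf ay) !andbF /=.
rewrite big1 ?add0n; last by move=> W WA; rewrite (csub_notin xA WA).
rewrite !addn0 ?add0n; congr addn; apply: eq_bigr => W /andP[WA aW].
  by rewrite !inE eqxx aW orbT (cards_csubU xA WA).
by rewrite !inE eqxx aW !orbT (cards_csubU2 xA yA WA).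
Qed.

Lemma path2_sum_xy (U : finType) (e : rel U) (A : {set U}) a x y (h : nat -> nat) :
  symmetric e -> pendant e A a x -> pendant e (x |: A) x y ->
  \sum_(W in csub e (y |: (x |: A)) | (x \in W) && (y \in W)) h #|W| =
    h 2 + \sum_(W in csub e A | a \in W) h #|W|.+2.
Proof.
move=> se px py; have [xA aA _] := px; have [yA _ _] := py.
have xy : x != y by apply: contraNneq yA => <-; rewrite setU11.
have yA' : y \notin A by apply: contra yA => yA; rewrite inE yA orbT.
rewrite big_mkcondr (csub_sum_path2 _ se px py) !inE eq_sym (negPf xy) andbF !eqxx orbT /=.
rewrite big1 ?add0n; last by move=> W WA; rewrite (csub_notin xA WA).
rewrite big1 ?add0n; last first.
  by move=> W /andP[WA _]; rewrite !inE eq_sym (negPf xy) (csub_notin yA' WA) andbF.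
rewrite cards2 eq_sym xy; congr addn; apply: eq_bigr => W /andP[WA aW].
by rewrite !inE !eqxx !orbT (cards_csubU2 xA yA WA).
Qed.

Lemma path2_sum_axy (U : finType) (e : rel U) (A : {set U}) a x y (h : nat -> nat) :
  symmetric e -> pendant e A a x -> pendant e (x |: A) x y ->
  \sum_(W in csub e (y |: (x |: A)) | [&& y \in W, a \in W & x \in W]) h #|W| =
    \sum_(W in csub e A | a \in W) h #|W|.+2.
Proof.
move=> se px py; have [xA aA _] := px; have [yA _ _] := py.
have ax : a != x by apply: contraTneq aA => ->.
have ay : a != y by apply: contraNneq yA => <-; rewrite inE aA orbT.
have yx : y != x by apply: contraNneq yA => ->; rewrite setU11.
have yA' : y \notin A by apply: contra yA => yA; rewrite inE yA orbT.
rewrite big_mkcondr (csub_sum_path2 _ se px py) !inE (negPf ax) (negPf ay) !andbF /=.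
rewrite big1 ?add0n; last by move=> W WA; rewrite (csub_notin yA' WA).
rewrite big1 ?add0n; last first.
  by move=> W /andP[WA _]; rewrite !inE (negPf yx) (csub_notin yA' WA).
apply: eq_bigr => W /andP[WA aW].
by rewrite !inE !eqxx aW !orbT (cards_csubU2 xA yA WA).
Qed.

Lemma star2_sum_axy (U : finType) (e : rel U) (A : {set U}) a x y (h : nat -> nat) :
  symmetric e -> pendant e A a x -> pendant e (x |: A) a y ->
  \sum_(W in csub e (y |: (x |: A)) | [&& y \in W, x \in W & a \in W]) h #|W| =
    \sum_(W in csub e A | a \in W) h #|W|.+2.
Proof.
move=> se px py; have [xA aA _] := px; have [yA _ _] := py.
have ax : a != x by apply: contraTneq aA => ->.
have yx : y != x by apply: contraNneq yA => ->; rewrite setU11.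
have ay : a != y by apply: contraNneq yA => <-; rewrite inE aA orbT.
have yA' : y \notin A by apply: contra yA => yA; rewrite inE yA orbT.
rewrite big_mkcondr (csub_sum_star2 _ se px py) !inE (negPf ax) (negPf ay) !andbF /=.
rewrite big1 ?add0n; last by move=> W WA; rewrite (csub_notin yA' WA).
rewrite big1 ?add0n; last first.
  by move=> W /andP[WA _]; rewrite !inE (negPf yx) (csub_notin yA' WA).
rewrite big1 ?add0n; last first.
  by move=> W /andP[WA _]; rewrite !inE eq_sym (negPf yx) (csub_notin xA WA) andbF.
apply: eq_bigr => W /andP[WA aW].
by rewrite !inE !eqxx aW !orbT (cards_csubU2 xA yA WA).
Qed.

Lemma sum_addn (I : finType) (P : pred I) (F : I -> nat) k :
  \sum_(i | P i) (k + F i) = \sum_(i | P i) F i + k * \sum_(i | P i) 1.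
Proof.
rewrite big_split /= addnC big_distrr /=; congr addn.
by apply: eq_bigr => i _; rewrite muln1.
Qed.

(** Let [s0], [t0] be total order and number of the connected sets in [A], and [s], [f] those of the
    sets through [w]. The tree gives [s0 + 2 * s + 3 * f + 4] and [t0 + 2 * f + 3], the new subtrees
    [3 * s + 5 * f] and [3 * f]. After expansion Jamison's [s0 * f <= t0 * s] bounds the term in
    [s0], and the rest compares directly since [f] is positive. *)
Lemma path_case_ineq (U : finType) (e e1 e2 : rel U) (A V : {set U}) u v w :
  symmetric e -> symmetric e1 -> symmetric e2 ->
  {in A &, e1 =2 e} -> {in A &, e2 =2 e} ->
  pendant e A w v -> pendant e (v |: A) v u ->
  pendant e1 A w u -> pendant e1 (u |: A) u v ->
  pendant e2 A w v -> pendant e2 (v |: A) w u ->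
  rtree e A w ->
  V = u |: (v |: A) ->
  (\sum_(W in csub e V) #|W|)
    * (\sum_(W in csub e1 V | (u \in W) && (w \in W)) 1
       + \sum_(W in csub e2 V | [&& u \in W, v \in W & w \in W]) 1)
  < (\sum_(W in csub e1 V | (u \in W) && (w \in W)) #|W|
       + \sum_(W in csub e2 V | [&& u \in W, v \in W & w \in W]) #|W|)
    * \sum_(W in csub e V) 1.
Proof.
move=> se se1 se2 ee1 ee2 pv pu p1u p1v p2v p2u rt VE.
have V1 : V = v |: (u |: A) by rewrite VE setUCA.
rewrite [in csub e1 _]V1 VE.
rewrite (path2_sum id se pv pu) (path2_sum (fun=> 1) se pv pu).
rewrite (path2_sum_ax id se1 p1u p1v) (path2_sum_ax (fun=> 1) se1 p1u p1v).
rewrite (star2_sum_axy id se2 p2v p2u) (star2_sum_axy (fun=> 1) se2 p2v p2u).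
rewrite (csub_eq ee1) (csub_eq ee2) (sum_addn _ _ 1) (sum_addn _ _ 2).
have jam := rtree_mean_le se rt.
have cnt := rtree_count se rt.
have f_le := csub_count_le e A (fun W => w \in W).
have f_gt0 : 0 < \sum_(W in csub e A | w \in W) 1.
  by apply: leq_trans cnt; apply/card_gt0P; exists w; case: pv.
move: jam f_le f_gt0.
move: (\sum_(W in csub e A) #|W|) (\sum_(W in csub e A) 1) => s0 t0.
move: (\sum_(W in csub e A | w \in W) #|W|) (\sum_(W in csub e A | w \in W) 1) => s f.
move=> jam f_le f_gt0.
nia.
Qed.

(** With [s], [f] now for the sets through [v], the tree gives [s0 + 3 * s + 4 * f + 2] and
    [t0 + 3 * f + 2], the new subtrees [2 * s + 4 * f + 2] and [2 * f + 1]. The summand 1, due to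
    the set of [u] and [w] alone, leaves a term [s0] beyond the reach of Jamison's inequality. *)
Lemma star_case_ineq (U : finType) (e e1 e2 : rel U) (A V : {set U}) u v w :
  symmetric e -> symmetric e1 -> symmetric e2 ->
  {in A &, e1 =2 e} -> {in A &, e2 =2 e} ->
  pendant e A v w -> pendant e (w |: A) v u ->
  pendant e1 A v u -> pendant e1 (u |: A) u w ->
  pendant e2 A v w -> pendant e2 (w |: A) w u ->
  rtree e A v ->
  V = u |: (w |: A) ->
  (\sum_(W in csub e V) #|W|)
    * (\sum_(W in csub e1 V | (u \in W) && (w \in W)) 1
       + \sum_(W in csub e2 V | [&& u \in W, v \in W & w \in W]) 1)
  < (\sum_(W in csub e1 V | (u \in W) && (w \in W)) #|W|
       + \sum_(W in csub e2 V | [&& u \in W, v \in W & w \in W]) #|W|)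
    * \sum_(W in csub e V) 1.
Proof.
move=> se se1 se2 ee1 ee2 pw pu p1u p1w p2w p2u rt VE.
have V1 : V = w |: (u |: A) by rewrite VE setUCA.
rewrite [in csub e1 _]V1 VE.
rewrite (star2_sum id se pw pu) (star2_sum (fun=> 1) se pw pu).
rewrite (path2_sum_xy id se1 p1u p1w) (path2_sum_xy (fun=> 1) se1 p1u p1w).
rewrite (path2_sum_axy id se2 p2w p2u) (path2_sum_axy (fun=> 1) se2 p2w p2u).
rewrite (csub_eq ee1) (csub_eq ee2) (sum_addn _ _ 1) (sum_addn _ _ 2).
have jam := rtree_mean_le se rt.
have cnt := rtree_count se rt.
have f_le := csub_count_le e A (fun W => v \in W).
have f_gt0 : 0 < \sum_(W in csub e A | v \in W) 1.
  by apply: leq_trans cnt; apply/card_gt0P; exists v; case: pw.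
(* The leftover [s0] is at most [#|A| * t0], hence at most [f * t0], because at least [#|A|] sets
   pass through [v]. *)
have s0_le : \sum_(W in csub e A) #|W|
    <= (\sum_(W in csub e A | v \in W) 1) * \sum_(W in csub e A) 1.
  apply: leq_trans (_ : #|A| * \sum_(W in csub e A) 1 <= _).
    by have := csub_weight_le e A xpredT; rewrite !big_mkcondr.
  by rewrite leq_mul2r cnt orbT.
move: jam f_le f_gt0 s0_le.
move: (\sum_(W in csub e A) #|W|) (\sum_(W in csub e A) 1) => s0 t0.
move: (\sum_(W in csub e A | v \in W) #|W|) (\sum_(W in csub e A | v \in W) 1) => s f.
move=> jam f_le f_gt0 s0_le.
nia.
Qed.

(** * Longest paths and the end of a tree *)

Definition longest_path (U : finType) (e : rel U) (c : seq U) : Prop :=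
  [/\ uniq c, sorted e c
    & forall d : seq U, uniq d -> sorted e d -> size d <= size c].

Lemma longest_path_exists (U : finType) (e : rel U) (c : seq U) :
  uniq c -> sorted e c ->
  exists d, longest_path e d /\ size c <= size d.
Proof.
move=> uc sc.
pose P n := [exists t : n.-tuple U, uniq t && sorted e t].
have Pseq d : uniq d -> sorted e d -> P (size d).
  by move=> ud sd; apply/existsP; exists (in_tuple d); rewrite ud.
have leP n : P n -> n <= #|U|.
  by case/existsP=> t /andP[ut _]; rewrite -(size_tuple t) -(card_uniqP ut) max_card.
case: (ex_maxnP (ex_intro P _ (Pseq c uc sc)) leP) => n Pn maxn.
case/existsP: Pn => t /andP[ut st]; exists t; rewrite size_tuple; split; last exact/maxn/Pseq.
by split=> // d ud sd; rewrite size_tuple; apply/maxn/Pseq.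
Qed.

(** The edge from [x] to a vertex of [p] would close a cycle with the initial segment of the path up
    to that vertex. *)
Lemma acyc_chord (U : finType) (e : rel U) x y p z :
  symmetric e -> acyc e -> uniq (x :: y :: p) -> path e x (y :: p) ->
  e x z -> z \notin p.
Proof.
move=> se ac up pp exz; apply/negP => zp.
case/splitPr: zp up pp => p1 p2; rewrite -cat_rcons.
rewrite -[_ :: _]/([:: x, y & rcons p1 z] ++ p2) cat_uniq => /and3P[up _ _].
rewrite /= cat_path => /and3P[exy pyp _].
apply: (ac [:: x, y & rcons p1 z]); first by rewrite /= size_rcons.
by rewrite /ucycle up /= rcons_path exy pyp last_rcons se exz.
Qed.

(** A neighbour of [x] other than [y] is off the path, since there are no chords, and would prolong
    it. *)
Lemma longest_path_end (U : finType) (e : rel U) x y p z :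
  symmetric e -> irreflexive e -> acyc e -> longest_path e (x :: y :: p) ->
  e x z -> z = y.
Proof.
move=> se ie ac [up sp mp] exz; apply/eqP; apply: contraT => zy.
have zc : z \notin [:: x, y & p].
  rewrite !inE (negPf zy) (negPf (acyc_chord se ac up sp exz)) !orbF /=.
  by apply: contraTneq exz => ->; rewrite ie.
have := mp (z :: x :: y :: p); rewrite ltnn; apply.
  by rewrite cons_uniq zc.
by move: sp => /= ->; rewrite se exz.
Qed.

(** Among three vertices, either two are joined by a simple path with an inner vertex, or all are
    adjacent and [x], [y], [z] is itself a path. *)
Lemma conn_path3 (U : finType) (e : rel U) (V : {set U}) :
  conn e V -> 2 < #|V| ->
  exists x y z p, uniq [:: x, y, z & p] /\ sorted e [:: x, y, z & p].
Proof.
move=> /connP cV /card_gt2P[x [y [z [[xV yV zV] [xy yz zx]]]]].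
have aux a b : a \in V -> b \in V -> a != b ->
    (exists x y z p, uniq [:: x, y, z & p] /\ sorted e [:: x, y, z & p]) \/ e a b.
  move=> aV bV ab; have /connectP[p0 pp0] := cV a b aV bV.
  case: (shortenP pp0) => p pp up _ bl.
  have {}pp : path e a p by apply: sub_path pp => i j /and3P[].
  case: p bl up pp => [ba|i [|j q]] /=.
  - by rewrite ba eqxx in ab.
  - by move=> -> _; rewrite andbT; right.
  - by move=> _ up pp; left; exists a, i, j, q.
case: (aux x y xV yV xy) => // exy; case: (aux y z yV zV yz) => // eyz.
exists x, y, z, [::]; rewrite /= exy eyz !inE (negPf xy) (negPf yz).
by rewrite eq_sym (negPf zx).
Qed.

(** The first vertices [u], [v], [w] of a longest path serve, unless [v] has a further neighbour,
    which then replaces [w]. *)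
Lemma tree_end (U : finType) (e : rel U) (V : {set U}) :
  symmetric e -> irreflexive e -> acyc e -> conn e V -> 2 < #|V| ->
  exists u v w, [/\ u != w, e u v, e v w, forall z, e u z -> z = v
    & (forall z, e w z -> z = v) \/ (forall z, e v z -> z = u \/ z = w)].
Proof.
move=> se ie ac cV V2; have [x [y [z [p [up sp]]]]] := conn_path3 cV V2.
have [[|u [|v [|w q]]] [lp //= _]] := longest_path_exists up sp.
have [uq sq mq] := lp.
have [uw euv evw] : [/\ u != w, e u v & e v w].
  move: uq sq => /=; rewrite !inE !negb_or => /and3P[/and3P[_ -> _] _ _].
  by case/and3P=> -> ->.
have uvq : uniq [:: v, w & q] by case/andP: uq.
have svq : path e v (w :: q) by case/andP: sq.
have endu z' : e u z' -> z' = v by exact: longest_path_end lp.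
case: (pickP (fun t => [&& e v t, t != u & t != w])) => [t /and3P[evt tu tw] | no].
  (* Replacing [u] by [t] gives another path of maximal length, so [t] is a leaf too. *)
  exists u, v, t; split=> //; first by rewrite eq_sym.
  left=> z'; apply: (@longest_path_end _ e t v (w :: q)) => //.
  have ut : uniq [:: t, v, w & q].
    have vt : t != v by apply: contraTneq evt => ->; rewrite ie.
    rewrite cons_uniq uvq andbT !inE (negPf vt) (negPf tw) /=.
    exact: acyc_chord se ac uvq svq evt.
  by split=> //; rewrite /= se evt.
by exists u, v, w; split=> //; right=> z' evz; have := no z'; rewrite evz /=;
  case: eqP => [->|_]; [left | case: eqP => // ->; right].
Qed.

(** * Adding the edge *)

Lemma mean_subtree_orderE (U : finType) (G : graph U) :
  mean_subtree_order G =
    ((\sum_(S in subtrees G) graph_order S)%N%:R / (\sum_(S in subtrees G) 1)%N%:R)%R.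
Proof.
rewrite /mean_subtree_order /subtree_poly GRing.raddf_sum /= !horner_sum !GRing.natr_sum.
congr (_ / _)%R; apply: eq_bigr => S _; last by rewrite hornerXn GRing.expr1n.
by rewrite derivXn hornerMn hornerXn GRing.expr1n.
Qed.

Lemma mean_subtree_order_lt (U : finType) (T H : graph U) :
  (\sum_(S in subtrees T) graph_order S) * (\sum_(S in subtrees H) 1)
    < (\sum_(S in subtrees H) graph_order S) * (\sum_(S in subtrees T) 1) ->
  (mean_subtree_order T < mean_subtree_order H)%R.
Proof.
rewrite !mean_subtree_orderE !sum1_card.
(* If either graph had no subtree, the right-hand side would be 0; so both denominators are
   positive. *)
have [-> | H0] := eqVneq (subtrees H) set0.
  by rewrite cards0 big_set0 muln0.
move: H0; rewrite -card_gt0; move: (\sum_(S in subtrees T) graph_order S) => sT.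
move: (\sum_(S in subtrees H) graph_order S) => sH.
have [-> | T0 H0 lt] := posnP #|subtrees T|; first by rewrite muln0.
rewrite Num.Theory.ltr_pdivrMr ?Num.Theory.ltr0n //.
rewrite GRing.mulrAC Num.Theory.ltr_pdivlMr ?Num.Theory.ltr0n //.
by rewrite -!GRing.natrM Num.Theory.ltr_nat.
Qed.

Lemma set2_eq (U : finType) (x y a b : U) :
  ([set x; y] == [set a; b]) = (x == a) && (y == b) || (x == b) && (y == a).
Proof.
apply/eqP/idP => [E | /orP[] /andP[/eqP-> /eqP->] //]; last by rewrite setUC.
have : x \in [set a; b] by rewrite -E set21.
have : y \in [set a; b] by rewrite -E set22.
have : a \in [set x; y] by rewrite E set21.
have : b \in [set x; y] by rewrite E set22.
rewrite !inE (eq_sym a x) (eq_sym a y) (eq_sym b x) (eq_sym b y).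
by do !case: eqP => //= ?; subst.
Qed.

Lemma add_edge_is_graph (U : finType) (G : graph U) u w :
  u \in vertices G -> w \in vertices G -> u != w ->
  is_graph (vertices G, [set u; w] |: edges G).
Proof.
move=> uG wG uw; apply/forall_inP => f /setU1P[-> | fG] /=.
  by rewrite cards2 uw subUset !sub1set uG.
by rewrite (edge_card2 fG) /= ?(subset_trans (edge_sub fG)) ?subxx.
Qed.

Lemma del_edge_is_graph (U : finType) (G : graph U) f :
  is_graph (vertices G, edges G :\ f).
Proof.
by apply/forall_inP => f' /setD1P[_ fG] /=; rewrite (edge_card2 fG) (edge_sub fG).
Qed.

Definition del_edge (U : finType) (G : graph U) f : graph U :=
  Graph (del_edge_is_graph G f).

Lemma adjacent_del_edge (U : finType) (G : graph U) f x y :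
  adjacent (del_edge G f) x y = ([set x; y] != f) && adjacent G x y.
Proof. by rewrite /adjacent /= !inE. Qed.

Lemma sum_subtreesT (U : finType) (G : graph U) (g : {set U} -> nat) :
  acyclic G ->
  \sum_(S in subtrees G) g (vertices S) = \sum_(W in csub (adjacent G) (vertices G)) g W.
Proof. by move=> acG; have := sum_subtrees xpredT g acG; rewrite !big_mkcondr. Qed.

(** The mean of [H] is a weighted average of that of [T] and that of the new subtrees, so it
    suffices that the latter is larger; the products involving only [T] cancel. *)
Lemma mean_lt_triangle (U : finType) (T H H1 H2 : graph U) u v w :
  is_tree T ->
  u != v -> v != w -> u != w ->
  [set u; v] \in edges T -> [set v; w] \in edges T -> [set u; w] \notin edges T ->
  vertices H = vertices T -> edges H = [set u; w] |: edges T ->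
  vertices H1 = vertices T -> edges H1 = edges H :\ [set v; w] ->
  vertices H2 = vertices T -> edges H2 = edges H :\ [set u; v] ->
  acyclic H1 -> acyclic H2 ->
  (\sum_(W in csub (adjacent T) (vertices T)) #|W|)
    * (\sum_(W in csub (adjacent H1) (vertices T) | (u \in W) && (w \in W)) 1
       + \sum_(W in csub (adjacent H2) (vertices T) | [&& u \in W, v \in W & w \in W]) 1)
  < (\sum_(W in csub (adjacent H1) (vertices T) | (u \in W) && (w \in W)) #|W|
     + \sum_(W in csub (adjacent H2) (vertices T) | [&& u \in W, v \in W & w \in W]) #|W|)
    * \sum_(W in csub (adjacent T) (vertices T)) 1 ->
  (mean_subtree_order T < mean_subtree_order H)%R.
Proof.
move=> /and3P[_ _ acT] uv vw uw Tuv Tvw Tuw VH EH VH1 EH1 VH2 EH2 ac1 ac2 lt.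
have tri g := sum_subtrees_triangle g uv vw uw Tuv Tvw Tuw VH EH VH1 EH1 VH2 EH2 ac1 ac2.
apply: mean_subtree_order_lt; rewrite (tri (fun W => #|W|)) (tri (fun=> 1)).
rewrite mulnDr mulnDl ltn_add2l.
rewrite (sum_subtrees (fun W => (u \in W) && (w \in W)) (fun W => #|W|) ac1).
rewrite (sum_subtrees (fun W => (u \in W) && (w \in W)) (fun=> 1) ac1).
rewrite (sum_subtrees (fun W => [&& u \in W, v \in W & w \in W]) (fun W => #|W|) ac2).
rewrite (sum_subtrees (fun W => [&& u \in W, v \in W & w \in W]) (fun=> 1) ac2).
by rewrite (sum_subtreesT (fun W => #|W|) acT) (sum_subtreesT (fun=> 1) acT) VH1 VH2.
Qed.

Lemma connected_conn (U : finType) (G : graph U) :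
  connected G = conn (adjacent G) (vertices G).
Proof.
apply: eq_forallb_in => x _; apply: eq_forallb_in => y _; apply: eq_connect => a b.
rewrite /restr /=; apply/idP/and3P => [ab | []//].
by have /andP[] := adjacent_mem ab.
Qed.

Lemma conn_del_pendant (U : finType) (e : rel U) (A : {set U}) y x :
  symmetric e -> pendant e A y x -> conn e (x |: A) -> conn e A.
Proof.
move=> se px; have [xA yA _] := px; rewrite setUC => cA.
have := conn_bridge_side se (pendant_bridge se px) (subxx _) cA.
by rewrite inE yA => /(_ isT); rewrite setUK.
Qed.

Theorem theorem4p1 (U : finType) (T : graph U) (T_tree : is_tree T)
    (T_order : 3 <= graph_order T) :
  exists (H : graph U) (u v : U),
    [/\ [/\ u \in vertices T, v \in vertices T, u != v & ~~ adjacent T u v],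
        vertices H = vertices T,
        edges H = [set u; v] |: edges T
      & (mean_subtree_order T < mean_subtree_order H)%R].
Proof.
have /and3P[_ + /acyclicP acT] := T_tree; rewrite connected_conn => cT.
have se := @adjacent_sym _ T; have ie := @adjacent_irr _ T.
have [u [v [w [uw euv evw eu ewv]]]] := tree_end se ie acT cT T_order.
have uv : u != v by apply: contraTneq euv => ->; rewrite ie.
have vw : v != w by apply: contraTneq evw => ->; rewrite ie.
have [uT vT] := andP (adjacent_mem euv).
have [_ wT] := andP (adjacent_mem evw).
have euE z : adjacent T u z = (z == v) by apply/idP/eqP => [/eu|->].
(* The only neighbour of the leaf [u] is [v]. *)
have Tuw : ~~ adjacent T u w by rewrite euE eq_sym.
pose H := Graph (add_edge_is_graph uT wT uw).
exists H, u, w; split=> //.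
(* The two ways of breaking the triangle while keeping the new edge. *)
pose H1 := del_edge H [set v; w]; pose H2 := del_edge H [set u; v].
have se1 := @adjacent_sym _ H1; have se2 := @adjacent_sym _ H2.
have adjH x y : adjacent H x y = ([set x; y] == [set u; w]) || adjacent T x y.
  exact: in_setU1.
have e1E x y : adjacent H1 x y = ~~ ((x == v) && (y == w) || (x == w) && (y == v))
    && ((x == u) && (y == w) || (x == w) && (y == u) || adjacent T x y).
  by rewrite adjacent_del_edge adjH !set2_eq.
have e2E x y : adjacent H2 x y = ~~ ((x == u) && (y == v) || (x == v) && (y == u))
    && ((x == u) && (y == w) || (x == w) && (y == u) || adjacent T x y).
  by rewrite adjacent_del_edge adjH !set2_eq.
have [vu wv wu] : [/\ v != u, w != v & w != u] by rewrite ![_ == u]eq_sym [w == v]eq_sym.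
pose dist := (negPf uv, negPf vw, negPf uw, negPf vu, negPf wv, negPf wu, eqxx).
have e1u z : adjacent H1 u z = (z == v) || (z == w).
  by rewrite e1E euE !dist /= orbF orbC.
have e2u z : adjacent H2 u z = (z == w).
  by rewrite e2E euE !dist /= !orbF; case: eqP => [->|_]; rewrite ?dist ?orbF.
(* A cycle avoiding [u] would already be a cycle of [T], so only cycles through [u] have to be
   excluded. *)
have acH (e : rel U) :
    symmetric e -> (forall x y, x != u -> y != u -> e x y -> adjacent T x y) ->
    (forall c, ucycle e c -> 2 < size c -> u \notin c) -> acyc e.
  move=> syme sub nu c c2 uc; apply: (acT c c2).
  have uc' := nu c uc c2; case/andP: uc => cc uc; rewrite /ucycle uc andbT.
  apply: (sub_in_cycle (P := [pred x | x != u])) cc; first by move=> x y; apply: sub.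
  by apply/allP => x xc; apply: contraNneq uc' => <-.
have ac2 : acyc (adjacent H2).
  apply: acH => // [x y xu yu | c uc c2].
    by rewrite e2E (negPf xu) (negPf yu) !andbF /=.
  by apply: (ucycle_leaf se2 uc c2) => y z _ _; rewrite !e2u => /eqP-> /eqP->.
have sub1 x y : x != u -> y != u -> adjacent H1 x y -> adjacent T x y.
  by move=> xu yu; rewrite e1E (negPf xu) (negPf yu) !andbF /= => /andP[].
(* A set without [u] that does not contain both [v] and [w] spans none of the added or deleted
   edges. *)
have eqA (A : {set U}) : u \notin A -> ~~ ((v \in A) && (w \in A)) ->
    {in A &, adjacent H1 =2 adjacent T} /\ {in A &, adjacent H2 =2 adjacent T}.
  move=> uA vwA; have nu x : x \in A -> (x == u) = false.
    by move=> xA; apply: contraNF uA => /eqP <-.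
  split=> x y xA yA; rewrite ?e1E ?e2E !nu // !andbF //=.
  case: eqP => [xv | _] /=.
    case: eqP => [yw | _]; first by rewrite -xv -yw xA yA in vwA.
    by rewrite xv !dist.
  by case: eqP => //= xw; case: eqP => //= yv; rewrite -xw -yv xA yA in vwA.
case: ewv => [ew | ev].
(* Both [u] and [w] are leaves at [v]: the smaller tree omits them and is rooted at [v]. *)
- have ewE z : adjacent T w z = (z == v).
    by apply/idP/eqP => [/ew|->] //; rewrite se.
  have e1w z : adjacent H1 w z = (z == u).
    rewrite e1E ewE !dist /=; case: (eqVneq z v) => [->|zv]; rewrite ?dist //=.
    by rewrite orbF.
  have e2w z : adjacent H2 w z = (z == u) || (z == v).
    by rewrite e2E ewE !dist.
  have ac1 : acyc (adjacent H1).
    apply: acH => // c uc c2.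
    (* In [H1] the vertex [w] is a leaf at [u]; once it is excluded from the cycle, only [v] remains
       as a neighbour of [u]. *)
    have wc : w \notin c.
      by apply: (ucycle_leaf se1 uc c2) => y z _ _; rewrite !e1w => /eqP-> /eqP->.
    have nw y : y \in c -> (y == w) = false by move=> yc; apply: contraNF wc => /eqP<-.
    apply: (ucycle_leaf se1 uc c2) => y z yc zc; rewrite !e1u !nw // !orbF.
    by move=> /eqP-> /eqP->.
  pose A := vertices T :\ w :\ u.
  have uA : u \notin A by rewrite !inE eqxx.
  have wA : w \notin A by rewrite !inE eqxx andbF.
  have vA : v \in A by rewrite !inE vT vu vw.
  have VE : vertices T = u |: (w |: A).
    by rewrite setUCA setD1K ?setD1K // !inE uT uw.
  have nuA z : z \in A -> (z == u) = false by move=> zA; apply: contraNF uA => /eqP<-.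
  have nwA z : z \in A -> (z == w) = false by move=> zA; apply: contraNF wA => /eqP<-.
  have [ee1 ee2] := eqA A uA (introN andP (fun vwA => negP wA (proj2 vwA))).
  have pw : pendant (adjacent T) A v w by split=> // z _; rewrite ewE.
  have pu : pendant (adjacent T) (w |: A) v u.
    by split=> [||z _]; rewrite ?in_setU1 ?negb_or ?uw ?uA ?vA ?orbT ?euE.
  apply: (@mean_lt_triangle U T H H1 H2 u v w) => //; try exact/acyclicP.
  apply: (@star_case_ineq _ _ _ _ A) => //.
  + by split=> // z zA; rewrite e1u nwA // orbF.
  + by split=> [||z _]; rewrite ?in_setU1 ?negb_or ?wu ?wA ?eqxx ?e1w.
  + by split=> // z zA; rewrite e2w nuA.
  + by split=> [||z _]; rewrite ?in_setU1 ?negb_or ?uw ?uA ?eqxx ?e2u.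
  apply: conn_rtree => //.
  by apply: conn_del_pendant pw _ => //; apply: conn_del_pendant pu _; rewrite -?VE.
(* Now [v] has degree 2: the smaller tree omits [u] and [v] and is rooted at [w]. *)
have evE z : adjacent T v z = (z == u) || (z == w).
  apply/idP/orP => [/ev[]->|[]/eqP->] //; [by left | by right | by rewrite se].
have e1v z : adjacent H1 v z = (z == u).
  rewrite e1E evE !dist /=; case: (eqVneq z w) => [->|zv]; rewrite ?dist //=.
  by rewrite orbF.
have e2v z : adjacent H2 v z = (z == w).
  rewrite e2E evE !dist /=; case: (eqVneq z u) => [->|zv]; rewrite ?dist //=.
have ac1 : acyc (adjacent H1).
  apply: acH => // c uc c2.
  (* Here [v] is the leaf of [H1] at [u], and excluding it leaves [u] only the neighbour [w]. *)
  have vc : v \notin c.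
    by apply: (ucycle_leaf se1 uc c2) => y z _ _; rewrite !e1v => /eqP-> /eqP->.
  have nv y : y \in c -> (y == v) = false by move=> yc; apply: contraNF vc => /eqP<-.
  apply: (ucycle_leaf se1 uc c2) => y z yc zc; rewrite !e1u !nv //.
  by move=> /eqP-> /eqP->.
pose A := vertices T :\ v :\ u.
have uA : u \notin A by rewrite !inE eqxx.
have vA : v \notin A by rewrite !inE eqxx andbF.
have wA : w \in A by rewrite !inE wT wu wv.
have VE : vertices T = u |: (v |: A).
  by rewrite setUCA setD1K ?setD1K // !inE uT uv.
have nuA z : z \in A -> (z == u) = false by move=> zA; apply: contraNF uA => /eqP<-.
have nvA z : z \in A -> (z == v) = false by move=> zA; apply: contraNF vA => /eqP<-.
have [ee1 ee2] := eqA A uA (introN andP (fun vwA => negP vA (proj1 vwA))).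
have pv : pendant (adjacent T) A w v by split=> // z zA; rewrite evE nuA.
have pu : pendant (adjacent T) (v |: A) v u.
  by split=> [||z _]; rewrite ?in_setU1 ?negb_or ?uv ?uA ?eqxx ?euE.
apply: (@mean_lt_triangle U T H H1 H2 u v w) => //; try exact/acyclicP.
apply: (@path_case_ineq _ _ _ _ A) => //.
- by split=> // z zA; rewrite e1u nvA.
- by split=> [||z _]; rewrite ?in_setU1 ?negb_or ?vu ?vA ?eqxx ?e1v.
- by split=> // z zA; rewrite e2v.
- by split=> [||z _]; rewrite ?in_setU1 ?negb_or ?uv ?uA ?wA ?orbT ?e2u.
apply: conn_rtree => //.
by apply: conn_del_pendant pv _ => //; apply: conn_del_pendant pu _; rewrite -?VE.
Qed.
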